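(* Consider the system $x_{k+1}=Ax_k+w_k$ with $x_k\in\mathbb R^n$, $A\in\mathbb R^{n\times n}$ and $w_k(i)\in[-W(i)/2,W(i)/2]$ for $i=1,\dots,n$. Its state is sampled every $T$ steps and communicated with latency $d\le T$ and message failure probability $p_e$ with perfect acknowledgments, using the sequential quantization and estimation scheme described in the context, with $r_i$ bits for coordinate $i$. Let $A^T=\Phi^{-1}J\Phi$ be a Jordan decomposition of the $T$-th power of $A$, and suppose $A$ has only real eigenvalues. Suppose moreover that $$\big(p_e+(1-p_e)2^{-r_i}\big)\,|\lambda_i(A)|^T<1\qquad\text{for all } i=1,\dots,n.$$ Then the expected steady state estimation error is bounded by $$\limsup_{\ell\to\infty}\mathbb E\,\|x_{\ell T+d}-\hat x_{\ell T+d}\|\;\le\;\frac12\,\|A^d\Phi^{-1}\|\sum_{i=1}^n\Delta^*(i)+\sum_{m=0}^{d-1}\|A^m\|\sum_{i=1}^n\frac12W(i),$$ where $\Delta^*\in\mathbb R^n$ is the solution of the linear equation $$\Delta^*=\Big(p_eI+(1-p_e)\,\mathrm{diag}\{2^{-r_i}\}\Big)\Big(|J|\,\Delta^*+\sum_{m=0}^{T-1}|\Phi A^m|\,W\Big).$$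
   Context: **Notation.** $v(i)$ is the $i$-th entry of a vector $v$. $W\in\mathbb R^n$ has nonnegative entries $W(i)$. $|M|$ is the matrix of entrywise absolute values of $M$. $\|\cdot\|$ is the $\ell_1$ norm $\|v\|=\sum_i|v(i)|$ on vectors and the induced operator norm on matrices. A superscript $T$ on $A$ always denotes the $T$-th power (not transpose). $J$ is the (real) upper-triangular Jordan normal form of $A^T$, with superdiagonal entries $J_{i,i+1}\in\{0,1\}$ (terms with index $n+1$ are taken to be $0$). The eigenvalues $\lambda_i(A)$ of $A$ are listed with multiplicity so that the $i$-th diagonal entry of $J$ is $\lambda_i(A)^T$. **Communication model.** $T\ge1$ and $0\le d\le T$ are integers and $p_e\in[0,1]$. $r_1,\dots,r_n$ are fixed nonnegative integers with $\sum_i r_i=r$. For each $\ell=0,1,2,\dots$ the sensor samples $x_{\ell T}$ and sends an $r$-bit message, which requires a delay of $d$ time steps. At time $\ell T+d$ the message is either successfully decoded (probability $1-p_e$) or corrupted and discarded (probability $p_e$). The estimator knows which of the two occurred. Success/failure events of different messages are independent, and they do not depend on the state and disturbance. The estimator sends perfect acknowledgments to the sensor. **Quantization and estimation scheme.** Put $z_{\ell T}=\Phi x_{\ell T}$. Sensor and estimator maintain a box $\prod_i[L_\ell(i),U_\ell(i)]$ guaranteed to contain $z_{\ell T}$ before the $\ell$-th message is sent. For $\ell=0$ it is a known bounded box containing $z_0$. The sensor divides the $i$-th side uniformly into $2^{r_i}$ (closed) bins of equal length for each $i$, and sends the indices of the bins containing the coordinates $z_{\ell T}(i)$. - If the message fails,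 set $[L'_\ell(i),U'_\ell(i)]=[L_\ell(i),U_\ell(i)]$ for all $i$. - If it succeeds, let $[L'_\ell(i),U'_\ell(i)]$ be the transmitted bin in coordinate $i$, of length $2^{-r_i}(U_\ell(i)-L_\ell(i))$. The estimate $\hat z_{\ell T}$ is the center of the box $\prod_i[L'_\ell(i),U'_\ell(i)]$, and $\hat x_{\ell T}=\Phi^{-1}\hat z_{\ell T}$, $\hat x_{\ell T+d}=A^d\hat x_{\ell T}$. With $\mu_i=J_{ii}$, the next box is given by $$U_{\ell+1}(i)=\max\{\mu_iU'_\ell(i),\mu_iL'_\ell(i)\}+J_{i,i+1}U'_\ell(i+1)+\sum_{m=0}^{T-1}\sum_{j=1}^n|(\Phi A^m)_{ij}|\tfrac{W(j)}2,$$ $$L_{\ell+1}(i)=\min\{\mu_iU'_\ell(i),\mu_iL'_\ell(i)\}+J_{i,i+1}L'_\ell(i+1)-\sum_{m=0}^{T-1}\sum_{j=1}^n|(\Phi A^m)_{ij}|\tfrac{W(j)}2 .$$ **Expectation.** $\mathbb E$ is over the random decoding successes/failures. The bound is asserted for every initial state with $z_0=\Phi x_0$ in the initial box and every disturbance sequence with $w_k(i)\in[-W(i)/2,W(i)/2]$. *)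

(* Defs.v *)
From HB Require Import structures.
From mathcomp Require Import all_boot all_order all_algebra.
From mathcomp Require Import all_classical all_reals all_analysis.
Set Implicit Arguments.
Unset Strict Implicit.
Unset Printing Implicit Defensive.
Import Order.TTheory GRing.Theory Num.Theory.
Import numFieldNormedType.Exports.
Local Open Scope classical_set_scope.
Local Open Scope ring_scope.

Section LinearAlgebra.
Context {R : realType}.

(* The norm that the library puts on matrices is the max norm, hence the
   explicit l1 norm and its induced operator norm. *)
Definition norm1 n (v : 'cV[R]_n) : R := \sum_i `|v i 0|.

Definition opnorm1 n (M : 'M[R]_n) : R :=
  sup [set norm1 (M *m v) | v in [set v : 'cV[R]_n | norm1 v <= 1]].

Definition abs_mx m n (M : 'M[R]_(m, n)) : 'M[R]_(m, n) :=
  map_mx (fun x : R => `|x|) M.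

Definition jordan_form n (J : 'M[R]_n) : Prop :=
  forall i j : 'I_n,
    if j == i :> nat then True
    else if j == i.+1 :> nat then
      J i j = 0 \/ J i j = 1 /\ J i i = J j j
    else J i j = 0.

(* The eigenvalues of A counted with multiplicity. The factorization is over
   the real field R, so it says in particular that all the complex eigenvalues
   of A are real. *)
Definition real_eigenvalue_list n (A : 'M[R]_n) (lam : 'I_n -> R) : Prop :=
  char_poly A = \prod_(i < n) ('X - (lam i)%:P).

End LinearAlgebra.

Definition independent_events d (Omega : measurableType d) (R : realType)
    (P : probability Omega R) (E : nat -> set Omega) : Prop :=
  forall s : seq nat, uniq s ->
    P (\bigcap_(l in [set` s]) E l) = (\prod_(l <- s) P (E l))%E.

Record box (R : realType) (n : nat) :=
  Box { lower : 'cV[R]_n; upper : 'cV[R]_n }.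

Section Scheme.
Context {R : realType} {n : nat}.
Implicit Types (b : box R n) (z : 'cV[R]_n) (s : nat -> bool).

Definition in_box z b : Prop :=
  forall i, lower b i 0 <= z i 0 <= upper b i 0.

Fixpoint state (A : 'M[R]_n) (x0 : 'cV[R]_n) (w : nat -> 'cV[R]_n) (k : nat) :
    'cV[R]_n :=
  if k is k'.+1 then A *m state A x0 w k' + w k' else x0.

(* Bin number q i (counted from 0) in each coordinate i, out of 2 ^ r i. *)
Definition bin (r : 'I_n -> nat) b (q : 'I_n -> nat) : box R n :=
  let width i := (upper b i 0 - lower b i 0) / 2 ^+ r i in
  Box (\col_i (lower b i 0 + (q i)%:R * width i))
      (\col_i (lower b i 0 + (q i).+1%:R * width i)).

(* The bins are closed, so a coordinate on a common boundary lies in two of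
   them (or in all of them if the side is degenerate). The choice is left to
   the encoder, which may use the outcomes of the previous messages, the
   current box and the current value of z. *)
Definition encoder := seq bool -> box R n -> 'cV[R]_n -> 'I_n -> nat.

Definition valid_encoder (r : 'I_n -> nat) (enc : encoder) : Prop :=
  forall h b z, in_box z b ->
    (forall i, (enc h b z i < 2 ^ r i)%N) /\ in_box z (bin r b (enc h b z)).

Definition noise_margin (A Phi : 'M[R]_n) (W : 'cV[R]_n) (T : nat) (i : 'I_n) :
    R :=
  \sum_(m < T) \sum_(j < n) `|(Phi *m A ^+ m) i j| * (W j 0 / 2).

(* The sum over j = i + 1 is empty when i is the last index. *)
Definition next_box (A Phi J : 'M[R]_n) (W : 'cV[R]_n) (T : nat) b : box R n :=
  Box (\col_i (Num.min (J i i * upper b i 0) (J i i * lower b i 0)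
               + \sum_(j < n | j == i.+1 :> nat) J i j * lower b j 0
               - noise_margin A Phi W T i))
      (\col_i (Num.max (J i i * upper b i 0) (J i i * lower b i 0)
               + \sum_(j < n | j == i.+1 :> nat) J i j * upper b j 0
               + noise_margin A Phi W T i)).

(* s l tells whether the l-th message is successfully decoded. *)
Definition update_box (r : 'I_n -> nat) (enc : encoder) s (l : nat) b z :
    box R n :=
  if s l then bin r b (enc (mkseq s l) b z) else b.

Fixpoint box_before (A Phi J : 'M[R]_n) (W : 'cV[R]_n) (T : nat)
    (r : 'I_n -> nat) (enc : encoder) (b0 : box R n) (x : nat -> 'cV[R]_n)
    s (l : nat) : box R n :=
  if l is l'.+1 then
    next_box A Phi J W T
      (update_box r enc s l' (box_before A Phi J W T r enc b0 x s l')
         (Phi *m x (l' * T)%N))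
  else b0.

Definition box_after (A Phi J : 'M[R]_n) (W : 'cV[R]_n) (T : nat)
    (r : 'I_n -> nat) (enc : encoder) (b0 : box R n) (x : nat -> 'cV[R]_n)
    s (l : nat) : box R n :=
  update_box r enc s l (box_before A Phi J W T r enc b0 x s l)
    (Phi *m x (l * T)%N).

Definition center b : 'cV[R]_n := 2^-1 *: (lower b + upper b).

(* The estimate of the state at time l * T + d. *)
Definition estimate (A Phi J : 'M[R]_n) (W : 'cV[R]_n) (T d : nat)
    (r : 'I_n -> nat) (enc : encoder) (b0 : box R n) (x : nat -> 'cV[R]_n)
    s (l : nat) : 'cV[R]_n :=
  A ^+ d *m (invmx Phi *m center (box_after A Phi J W T r enc b0 x s l)).

Definition steady_width_eq (A Phi J : 'M[R]_n) (W : 'cV[R]_n) (T : nat)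
    (r : 'I_n -> nat) (pe : R) (Delta : 'cV[R]_n) : Prop :=
  Delta = (pe *: 1%:M + (1 - pe) *: diag_mx (\row_i (2 ^- r i)))
          *m (abs_mx J *m Delta + \sum_(m < T) abs_mx (Phi *m A ^+ m) *m W).

End Scheme.

(* Main.v *)
Require Import Defs.
From HB Require Import structures.
From mathcomp Require Import all_boot all_order all_algebra.
From mathcomp Require Import all_classical all_reals all_analysis measurable_realfun.
From mathcomp Require Import ring lra.
Set Implicit Arguments.
Unset Strict Implicit.
Unset Printing Implicit Defensive.
Import Order.TTheory GRing.Theory Num.Theory.
Import numFieldNormedType.Exports.
Local Open Scope classical_set_scope.
Local Open Scope ring_scope.

(* Whatever the encoder does, the widths V_l of the boxes obey a linear recursion
   driven only by the decoding outcomes: V_(l+1) = |J| G_l V_l + c, where G_l is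
   diag (2^-r_i) on success and the identity on failure, and
   c = sum_m |Phi A^m| W. As G_l is independent of V_l, the mean u_l of G_l V_l
   satisfies u_(l+1) = Q (|J| u_l + c) with Q = pe I + (1 - pe) diag (2^-r_i). The
   matrix Q |J| is upper triangular with diagonal entries in [0, 1), so u_l
   converges to the unique fixed point Delta. Since Phi x_(lT) stays in its box,
   its l1 distance to the center is at most half the sum of the widths, and the
   error is propagated over d steps by A^d Phi^-1 plus the fresh noise. *)

(** * The l1 operator norm, and affine iterations of an upper triangular matrix *)

Section LinearAlgebraLemmas.
Context {R : realType}.

Lemma norm1_ge0 n (v : 'cV[R]_n) : 0 <= norm1 v.
Proof. by apply: sumr_ge0. Qed.

Lemma norm10 n : norm1 (0 : 'cV[R]_n) = 0.
Proof. by rewrite /norm1 big1// => i _; rewrite mxE normr0. Qed.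

Lemma norm1D n (u v : 'cV[R]_n) : norm1 (u + v) <= norm1 u + norm1 v.
Proof.
rewrite /norm1 -big_split/=; apply: ler_sum => i _; rewrite mxE.
exact: ler_normD.
Qed.

Lemma norm1_sum n m (u : 'I_m -> 'cV[R]_n) :
  norm1 (\sum_k u k) <= \sum_k norm1 (u k).
Proof.
elim/big_ind2 : _ => // [|v a v' a' va va']; first by rewrite norm10.
by apply: (le_trans (norm1D _ _)); exact: lerD.
Qed.

Lemma norm1Z n (a : R) (v : 'cV[R]_n) : norm1 (a *: v) = `|a| * norm1 v.
Proof.
by rewrite /norm1 mulr_sumr; apply: eq_bigr => i _; rewrite mxE normrM.
Qed.

Lemma norm1_eq0 n (v : 'cV[R]_n) : norm1 v = 0 -> v = 0.
Proof.
move=> /eqP; rewrite psumr_eq0// => /allP v0.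
apply/colP => i; rewrite mxE; apply/eqP; rewrite -normr_eq0.
by apply: v0; rewrite mem_index_enum.
Qed.

(** Without an upper bound [sup] would only be a default value. On the unit ball every [|v j 0|] is
    at most 1, so the sum of all [|M i j|] is a bound. *)
Lemma opnorm1_has_ubound n (M : 'M[R]_n) :
  has_ubound [set norm1 (M *m v) | v in [set v : 'cV[R]_n | norm1 v <= 1]].
Proof.
exists (\sum_i \sum_j `|M i j|) => _ [v /= v1 <-].
apply: ler_sum => i _; rewrite mxE; apply: (le_trans (ler_norm_sum _ _ _)).
apply: ler_sum => j _; rewrite normrM ler_piMr//; apply: le_trans v1.
by rewrite /norm1 (bigD1 j)//= lerDl sumr_ge0.
Qed.

Lemma opnorm1_ge0 n (M : 'M[R]_n) : 0 <= opnorm1 M.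
Proof.
apply: ub_le_sup; first exact: opnorm1_has_ubound.
by exists 0; rewrite ?mulmx0 /= norm10 ?ler01.
Qed.

Lemma norm1_mulmx n (M : 'M[R]_n) (v : 'cV[R]_n) :
  norm1 (M *m v) <= opnorm1 M * norm1 v.
Proof.
have [/norm1_eq0 ->|v0] := eqVneq (norm1 v) 0.
  by rewrite mulmx0 norm10 mulr0.
have v_gt0 : 0 < norm1 v by rewrite lt_def v0 norm1_ge0.
have vE : v = norm1 v *: ((norm1 v)^-1 *: v) by rewrite scalerA divff// scale1r.
rewrite {1}vE -scalemxAr norm1Z gtr0_norm// mulrC ler_wpM2r ?norm1_ge0//.
apply: ub_le_sup; first exact: opnorm1_has_ubound.
exists ((norm1 v)^-1 *: v) => //=.
by rewrite norm1Z ger0_norm ?invr_ge0 ?norm1_ge0// mulVf.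
Qed.

(** Variation of constants: the index [j] counts back from the end, so [j = 0] carries the newest
    disturbance, and one more step shifts all the others by one. *)
Lemma state_add n (A : 'M[R]_n) x0 w k m :
  state A x0 w (k + m)%N = A ^+ m *m state A x0 w k
    + \sum_(j < m) A ^+ j *m w (k + (m - j.+1))%N.
Proof.
elim: m => [|m IHm].
  by rewrite addn0 expr0 mul1mx big_ord0 addr0.
rewrite addnS /= {}IHm mulmxDr mulmxA -[A *m A ^+ m]/(A * A ^+ m) -exprS.
rewrite -addrA; congr (_ + _).
rewrite big_ord_recl/= expr0 mul1mx subn1/= addrC; congr (_ + _).
rewrite mulmx_sumr; apply: eq_bigr => j _.
by rewrite mulmxA -[A *m A ^+ j]/(A * A ^+ j) -exprS.
Qed.

(* The weights K ^ i, with K large, make the off-diagonal part negligible. *)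
Lemma trig_contraction n (M : 'M[R]_n) :
  (forall i j : 'I_n, (j < i)%N -> M i j = 0) ->
  (forall i, `|M i i| < 1) ->
  exists K rho : R, [/\ 1 <= K, 0 <= rho < 1 & forall v : 'cV[R]_n,
    \sum_(i < n) K ^+ i * `|(M *m v) i 0| <= rho * \sum_(i < n) K ^+ i * `|v i 0|].
Proof.
move=> Mtrig Mdiag.
pose a := \big[Num.max/0]_i `|M i i|.
have a_ge0 : 0 <= a by exact: bigmax_ge_id.
have a_lt1 : a < 1 by exact: bigmax_lt.
pose B := \sum_i \sum_j `|M i j|.
have B_ge0 : 0 <= B by apply: sumr_ge0 => i _; exact: sumr_ge0.
(* Chosen so that [K * ((1 - a) / 2)] exceeds [B]. The off-diagonal part then costs at most
   [(1 - a) / 2], and the total factor is [a + (1 - a) / 2 = (1 + a) / 2]. *)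
pose K := 1 + 2 * B / (1 - a).
have K_ge1 : 1 <= K by rewrite lerDl divr_ge0// ?mulr_ge0// subr_ge0 ltW.
have K_gt0 : 0 < K by exact: lt_le_trans K_ge1.
have BK : B <= K * ((1 - a) / 2).
  have -> : K * ((1 - a) / 2) = (1 - a) / 2 + B.
    by rewrite /K; field; rewrite subr_eq0 gt_eqF.
  by rewrite lerDr divr_ge0// subr_ge0 ltW.
exists K, ((1 + a) / 2); split => // [|v]; first by apply/andP; split; lra.
(* Summing by columns leaves one claim per [j]: the weighted sum of column [j] is at most
   [(1 + a) / 2 * K ^+ j]. *)
apply: (@le_trans _ _ (\sum_(j < n) (\sum_(i < n) K ^+ i * `|M i j|) * `|v j 0|)).
  under [leRHS]eq_bigr do rewrite mulr_suml.
  rewrite exchange_big/=; apply: ler_sum => i _.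
  under [leRHS]eq_bigr do rewrite -mulrA.
  rewrite -mulr_sumr ler_wpM2l ?exprn_ge0 ?(ltW K_gt0)// mxE.
  by apply: (le_trans (ler_norm_sum _ _ _)); apply: ler_sum => j _; rewrite normrM.
rewrite mulr_sumr; apply: ler_sum => j _; rewrite mulrA ler_wpM2r//.
rewrite (bigD1 j)//=.
have aj : K ^+ j * `|M j j| <= K ^+ j * a.
  by rewrite ler_wpM2l ?exprn_ge0 ?(ltW K_gt0)//; exact: le_bigmax.
suff off : \sum_(i < n | i != j) K ^+ i * `|M i j| <= K ^+ j * ((1 - a) / 2).
  by apply: (le_trans (lerD aj off)); rewrite -mulrDr mulrC ler_wpM2r ?exprn_ge0 ?(ltW K_gt0)//; lra.
(* Column 0 vanishes off the diagonal. In a later column the nonzero off-diagonal entries lie in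
   rows [i < j], where the weight is at most [K ^+ j.-1]; the spare factor [K] absorbs [B]. *)
case: (posnP j) => [j0|j_gt0].
  rewrite big1 ?mulr_ge0 ?exprn_ge0 ?(ltW K_gt0) ?divr_ge0 ?subr_ge0 ?(ltW a_lt1)//.
  move=> i ij; rewrite Mtrig ?normr0 ?mulr0// j0 lt0n.
  by apply: contraNneq ij => i0; apply/eqP/val_inj; rewrite /= i0 j0.
rewrite -(prednK j_gt0) exprSr -mulrA.
apply: (@le_trans _ _ (K ^+ j.-1 * \sum_i `|M i j|)).
  rewrite mulr_sumr big_mkcond/=; apply: ler_sum => i _.
  case: ifPn => [ij|_]; last by rewrite mulr_ge0 ?exprn_ge0 ?(ltW K_gt0).
  have [ltij|ltji|/val_inj ijE] := ltngtP i j.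
  - by rewrite ler_wpM2r// ler_weXn2l// -ltnS prednK.
  - by rewrite Mtrig// normr0 !mulr0.
  - by rewrite ijE eqxx in ij.
rewrite ler_wpM2l ?exprn_ge0 ?(ltW K_gt0)//; apply: le_trans BK.
apply: ler_sum => i _; rewrite (bigD1 j)//= lerDl; exact: sumr_ge0.
Qed.

(** The weighted norm of [trig_contraction] decays geometrically, and it dominates each entry
    because [K] is at least 1. *)
Lemma trig_expr_cvg0 n (M : 'M[R]_n) (v : 'cV[R]_n) (i : 'I_n) :
  (forall i j : 'I_n, (j < i)%N -> M i j = 0) ->
  (forall i, `|M i i| < 1) ->
  (M ^+ k *m v) i 0 @[k --> \oo] --> 0.
Proof.
move=> Mtrig Mdiag.
have [K [rho [K_ge1 /andP[rho0 rho1] contr]]] := trig_contraction Mtrig Mdiag.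
pose N (u : 'cV[R]_n) := \sum_(i < n) K ^+ i * `|u i 0|.
have K_ge0 k : 0 <= K ^+ k by rewrite exprn_ge0// (le_trans ler01).
have NM k : N (M ^+ k *m v) <= rho ^+ k * N v.
  elim: k => [|k IHk]; first by rewrite !expr0 mul1mx mul1r.
  rewrite exprS -[M * M ^+ k]/(M *m M ^+ k) -mulmxA exprS -mulrA.
  by apply: (le_trans (contr _)); rewrite ler_wpM2l.
have geo : geometric (N v) rho @ \oo --> 0 by apply: cvg_geometric; rewrite ger0_norm.
apply/norm_cvg0P; apply: (squeeze_cvgr _ (cvg_cst 0) geo).
near=> k; rewrite normr_ge0/= mulrC (le_trans _ (NM k))//.
apply: (@le_trans _ _ (K ^+ i * `|(M ^+ k *m v) i 0|)).
  by rewrite ler_peMl// exprn_ege1.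
rewrite /N (bigD1 i)//= lerDl sumr_ge0// => j _; exact: mulr_ge0.
Unshelve. all: by end_near. Qed.

(** The determinant is the product of the [1 - M i i], none of which is zero. [det_trig] is about
    lower triangular matrices, hence the transpose. *)
Lemma trig_sub1_unit n (M : 'M[R]_n) :
  (forall i j : 'I_n, (j < i)%N -> M i j = 0) ->
  (forall i, `|M i i| < 1) ->
  1%:M - M \in unitmx.
Proof.
move=> Mtrig Mdiag; rewrite unitmxE -det_tr det_trig; last first.
  apply/is_trig_mxP => i j ij; rewrite !mxE Mtrig// subr0.
  by case: eqP => // /(congr1 val)/= ji; rewrite ji ltnn in ij.
rewrite unitfE prodf_seq_neq0; apply/allP => i _ /=.
rewrite !mxE eqxx subr_eq0 eq_sym; apply: contraTneq (Mdiag i) => ->.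
by rewrite normr1 ltxx.
Qed.

(** Subtracting the fixed point removes [c]: the deviation [u k - D] is multiplied by [M] at each
    step. *)
Lemma affine_iter_cvg n (M : 'M[R]_n) (c D : 'cV[R]_n) (u : nat -> 'cV[R]_n)
    (i : 'I_n) :
  (forall i j : 'I_n, (j < i)%N -> M i j = 0) ->
  (forall i, `|M i i| < 1) ->
  D = M *m D + c -> (forall k, u k.+1 = M *m u k + c) ->
  u k i 0 @[k --> \oo] --> D i 0.
Proof.
move=> Mtrig Mdiag DE uE.
have uD k : u k = D + M ^+ k *m (u 0%N - D).
  elim: k => [|k IHk]; first by rewrite expr0 mul1mx addrC subrK.
  rewrite uE IHk mulmxDr mulmxA -[M *m M ^+ k]/(M * M ^+ k) -exprS.
  by rewrite addrAC -DE.
have -> : (fun k => u k i 0) = (fun k => D i 0 + (M ^+ k *m (u 0%N - D)) i 0).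
  by apply/funext => k; rewrite uD mxE.
have := cvgD (@cvg_cst _ (D i 0) _ \oo _) (trig_expr_cvg0 (u 0%N - D) i Mtrig Mdiag).
by rewrite addr0; apply.
Qed.

End LinearAlgebraLemmas.

(** * One step of the box: widths and containment *)

Section BoxDynamics.
Context {R : realType} {n : nat}.
Implicit Types (b : box R n) (z : 'cV[R]_n) (A Phi J : 'M[R]_n).

Definition width b : 'cV[R]_n := upper b - lower b.

Lemma in_box_le z b i : in_box z b -> lower b i 0 <= upper b i 0.
Proof. by move=> /(_ i) /andP[]; exact: le_trans. Qed.

Definition gain (r : 'I_n -> nat) (decoded : bool) : 'M[R]_n :=
  diag_mx (\row_i (if decoded then 2 ^- r i else 1)).

(** All bins of a side have the same length, so the choice of the encoder disappears here and only
    the outcome [s l] remains. *)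
Lemma width_update (r : 'I_n -> nat) enc s l b z :
  width (update_box r enc s l b z) = gain r (s l) *m width b.
Proof.
rewrite /update_box /gain; apply/colP => i; rewrite mul_diag_mx.
case: (s l); rewrite !mxE ?mul1r//.
by rewrite opprD addrACA subrr add0r -mulrBl -natrB// subSnn mul1r mulrC.
Qed.

Lemma jordan_row J (v : 'cV[R]_n) i : jordan_form J ->
  (J *m v) i 0
    = J i i * v i 0 + \sum_(j < n | j == i.+1 :> nat) J i j * v j 0.
Proof.
move=> /(_ i) Ji; rewrite mxE (bigD1 i)//=; congr (_ + _).
rewrite (bigID (fun j : 'I_n => j == i.+1 :> nat))/= [X in _ + X]big1 ?addr0.
  apply: eq_bigl => j; rewrite andbC; case: eqVneq => //= ji.
  by apply/eqP => /(congr1 val)/= jE; move: ji; rewrite jE => /n_Sn.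
move=> j /andP[ji ji1]; have := Ji j.
rewrite (negbTE ji1); case: ifPn => [/eqP/val_inj jE|_ ->]; last by rewrite mul0r.
by rewrite jE eqxx in ji.
Qed.

Lemma jordan_abs J : jordan_form J -> jordan_form (abs_mx J).
Proof.
move=> JJ i j; have := JJ i j; case: ifP => // _.
rewrite !mxE; case: ifP => _; last by move=> ->; rewrite normr0.
by move=> [->|[-> ->]]; rewrite ?normr0 ?normr1; [left|right].
Qed.

(** This sign is why [next_box] can carry lower bounds to lower bounds along the superdiagonal, with
    a min and a max only on the diagonal. *)
Lemma jordan_succ_ge0 J (i j : 'I_n) : jordan_form J -> j = i.+1 :> nat ->
  0 <= J i j.
Proof.
move=> /(_ i j) Jij ji; move: Jij.
by rewrite ji eqxx gtn_eqF// => -[->|[->]].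
Qed.

Lemma noise_marginE A Phi (W : 'cV[R]_n) T i :
  noise_margin A Phi W T i
    = 2^-1 * (\sum_(m < T) abs_mx (Phi *m A ^+ m) *m W) i 0.
Proof.
rewrite summxE mulr_sumr; apply: eq_bigr => m _.
rewrite mxE mulr_sumr; apply: eq_bigr => j _.
by rewrite [abs_mx _ _ _]mxE; ring.
Qed.

Lemma width_next_box A Phi J (W : 'cV[R]_n) T b : jordan_form J ->
  (forall i, lower b i 0 <= upper b i 0) ->
  width (next_box A Phi J W T b)
    = abs_mx J *m width b + \sum_(m < T) abs_mx (Phi *m A ^+ m) *m W.
Proof.
move=> JJ bwf; apply/colP => i.
rewrite [RHS]mxE (jordan_row _ _ (jordan_abs JJ)) !mxE noise_marginE.
set N := (\sum_(m < T) abs_mx (Phi *m A ^+ m) *m W) i 0.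
have -> : \sum_(j < n | j == i.+1 :> nat) abs_mx J i j * width b j 0 =
    \sum_(j < n | j == i.+1 :> nat) J i j * upper b j 0
    - \sum_(j < n | j == i.+1 :> nat) J i j * lower b j 0.
  rewrite -sumrB; apply: eq_bigr => j /eqP ji.
  by rewrite !mxE ger0_norm ?mulrBr// jordan_succ_ge0.
(* A negative diagonal entry swaps the endpoints; since the side is ordered, max minus min is the
   scaled length for either sign. *)
have -> : `|J i i| * (upper b i 0 - lower b i 0) =
    Num.max (J i i * upper b i 0) (J i i * lower b i 0)
    - Num.min (J i i * upper b i 0) (J i i * lower b i 0).
  have := bwf i; case: (ger0P (J i i)) => [Ji0|Ji0] bi.
    by rewrite max_l ?min_r ?ler_wpM2l// mulrBr.
  by rewrite max_r ?min_l ?ler_wnM2l ?(ltW Ji0)// mulrBr !mulNr; ring.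
by field.
Qed.

Lemma in_next_box A Phi J (W : 'cV[R]_n) T b z (v : 'cV[R]_n) :
  jordan_form J -> in_box z b ->
  (forall i, `|v i 0| <= noise_margin A Phi W T i) ->
  in_box (J *m z + v) (next_box A Phi J W T b).
Proof.
move=> JJ zb vb i; rewrite [(_ + v) i 0]mxE (jordan_row _ _ JJ) !mxE.
have /ler_normlP[v1 v2] := vb i; have /andP[zl zu] := zb i.
have sl : \sum_(j < n | j == i.+1 :> nat) J i j * lower b j 0
    <= \sum_(j < n | j == i.+1 :> nat) J i j * z j 0.
  apply: ler_sum => j /eqP ji; rewrite ler_wpM2l ?jordan_succ_ge0//.
  by have /andP[] := zb j.
have su : \sum_(j < n | j == i.+1 :> nat) J i j * z j 0
    <= \sum_(j < n | j == i.+1 :> nat) J i j * upper b j 0.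
  apply: ler_sum => j /eqP ji; rewrite ler_wpM2l ?jordan_succ_ge0//.
  by have /andP[] := zb j.
have /andP[dl du] : Num.min (J i i * upper b i 0) (J i i * lower b i 0)
    <= J i i * z i 0 <= Num.max (J i i * upper b i 0) (J i i * lower b i 0).
  rewrite ge_min le_max; case: (ger0P (J i i)) => Ji0.
    by rewrite (ler_wpM2l Ji0 zl) (ler_wpM2l Ji0 zu) orbT.
  by rewrite (ler_wnM2l (ltW Ji0) zl) (ler_wnM2l (ltW Ji0) zu) orbT.
apply/andP; split.
  by rewrite lerD ?lerD// lerNl.
by rewrite lerD ?lerD.
Qed.

Lemma norm1_sub_center z b : in_box z b ->
  norm1 (z - Defs.center b) <= 2^-1 * \sum_i width b i 0.
Proof.
move=> zb; rewrite mulr_sumr; apply: ler_sum => i _.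
have /andP[zl zu] := zb i; rewrite !mxE.
by rewrite ler_norml; apply/andP; split; lra.
Qed.

End BoxDynamics.

(** * The scheme along one fixed sequence of outcomes *)

Section Scheme.
Context {R : realType} {n : nat}.
Context (A Phi J : 'M[R]_n) (W : 'cV[R]_n) (T d : nat) (r : 'I_n -> nat).
Context (enc : @encoder R n) (b0 : box R n) (x0 : 'cV[R]_n).
Context (w : nat -> 'cV[R]_n) (s : nat -> bool).
Hypothesis (enc_valid : valid_encoder r enc) (Phi_unit : Phi \in unitmx).
Hypothesis (J_jordan : jordan_form J) (A_jordan : A ^+ T = invmx Phi *m J *m Phi).
Hypothesis (x0_in : in_box (Phi *m x0) b0).
Hypothesis (w_bound : forall k i, - (W i 0 / 2) <= w k i 0 <= W i 0 / 2).
Let x := state A x0 w.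
Let before := box_before A Phi J W T r enc b0 x s.
Let after := box_after A Phi J W T r enc b0 x s.
Let noise := \sum_(m < T) abs_mx (Phi *m A ^+ m) *m W.

Lemma in_update_box l b z : in_box z b -> in_box z (update_box r enc s l b z).
Proof.
by rewrite /update_box; case: (s l) => // zb; have [] := enc_valid (mkseq s l) zb.
Qed.

(** From [Phi *m A ^+ T = J *m Phi], the sampled [z] evolves by [J] plus [Phi] applied to the noise
    of [T] steps, and the latter is within [noise_margin] entrywise. *)
Lemma in_box_before l : in_box (Phi *m x (l * T)%N) (before l).
Proof.
elim: l => [|l IHl] /=; first by rewrite mul0n.
rewrite mulSnr /x state_add -/x A_jordan mulmxDr !mulmxA mulmxV// mul1mx.
rewrite -mulmxA; apply: in_next_box => //; first exact: in_update_box.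
move=> i; rewrite mulmx_sumr summxE.
apply: (le_trans (ler_norm_sum _ _ _)); apply: ler_sum => m _.
rewrite mulmxA mxE; apply: (le_trans (ler_norm_sum _ _ _)); apply: ler_sum => j _.
by rewrite normrM ler_wpM2l// ler_norml.
Qed.

Lemma in_box_after l : in_box (Phi *m x (l * T)%N) (after l).
Proof. exact/in_update_box/in_box_before. Qed.

(** Neither the state nor the encoder occurs, so the widths become a function of the outcomes [t]
    alone. The gain comes outermost because the estimate uses the box after message [l]. *)
Fixpoint width_after (c V : 'cV[R]_n) (t : nat -> bool) (l : nat) : 'cV[R]_n :=
  gain r (t l) *m (if l is l'.+1 then abs_mx J *m width_after c V t l' + c else V).

Lemma width_box_after l : width (after l) = width_after noise (width b0) s l.
Proof.
elim: l => [|l IHl]; first exact: width_update.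
rewrite /after /box_after width_update /= -IHl width_next_box// => i.
exact: in_box_le (in_box_after l).
Qed.

(** The bound holds for every outcome sequence and is affine in the widths, so taking expectations
    will require only the mean widths. *)
Lemma estimate_error_le l :
  norm1 (x (l * T + d)%N - estimate A Phi J W T d r enc b0 x s l)
  <= 2^-1 * opnorm1 (A ^+ d *m invmx Phi)
       * (\sum_i width_after noise (width b0) s l i 0)
     + \sum_(m < d) opnorm1 (A ^+ m) * (\sum_i 2^-1 * W i 0).
Proof.
rewrite {1}/x state_add -/x /estimate -/after addrAC.
apply: (le_trans (norm1D _ _)); apply: lerD.
  have -> : A ^+ d *m x (l * T)%N - A ^+ d *m (invmx Phi *m Defs.center (after l))
      = A ^+ d *m invmx Phi *m (Phi *m x (l * T)%N - Defs.center (after l)).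
    by rewrite mulmxBr !mulmxA -[_ *m invmx Phi *m Phi]mulmxA mulVmx// mulmx1.
  apply: (le_trans (norm1_mulmx _ _)).
  rewrite -width_box_after [2^-1 * _]mulrC -mulrA.
  by rewrite ler_wpM2l ?opnorm1_ge0// norm1_sub_center//; exact: in_box_after.
apply: (le_trans (norm1_sum _)); apply: ler_sum => m _.
apply: (le_trans (norm1_mulmx _ _)); rewrite ler_wpM2l ?opnorm1_ge0//.
by apply: ler_sum => i _; rewrite mulrC ler_norml.
Qed.

End Scheme.

(** * Means of bounded variables that are uncorrelated with later outcomes *)

Section MeanIndependence.
Context {R : realType} {disp : measure_display} {Omega : measurableType disp}.
Context (P : probability Omega R) (E : nat -> set Omega) (p : R).
Hypothesis E_meas : forall l, measurable (E l).
Hypothesis E_prob : forall l, P (E l) = p%:E.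
Hypothesis E_indep : independent_events P E.

(* With s = [::] this says that y is the mean of Y. Allowing every s beyond l,
   rather than a single index, is what makes the property stable under the
   recursion for the box widths. *)
Definition mean_indep (l : nat) (Y : Omega -> R) (y : R) : Prop :=
  [/\ measurable_fun setT Y, exists M, forall om, `|Y om| <= M &
      forall s, uniq s -> all (leq l) s ->
        (\int[P]_om (Y om * \prod_(k <- s) \1_(E k) om))%R = y * p ^+ size s].

Lemma measurable_prod_indic s :
  measurable_fun setT (fun om => \prod_(k <- s) \1_(E k) om : R).
Proof.
elim: s => [|k s IHs].
  by under eq_fun do rewrite big_nil; exact: measurable_cst.
under eq_fun do rewrite big_cons.
by apply: measurable_funM => //; exact: measurable_indic.
Qed.

(** Passes to the intersections in terms of which [independent_events] is stated. *)
Lemma prod_indicE s om :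
  \prod_(k <- s) \1_(E k) om = \1_(\bigcap_(k in [set` s]) E k) om :> R.
Proof.
elim: s => [|k s IHs]; first by rewrite big_nil set_nil bigcap_set0 indicT.
have -> : [set` k :: s] = k |` [set` s].
  by apply/seteqP; split => j /=; rewrite inE => /predU1P.
by rewrite big_cons IHs bigcap_setU1 indicI.
Qed.

Lemma mean_indep_integrable l Y y s : mean_indep l Y y ->
  P.-integrable setT (EFin \o (fun om => Y om * \prod_(k <- s) \1_(E k) om)).
Proof.
move=> [mY [M YM] _]; apply: measurable_bounded_integrable => //.
- exact: (le_lt_trans (probability_le1 P measurableT) (ltry _)).
- by apply: measurable_funM => //; exact: measurable_prod_indic.
exists M; split => [|K MK om _]; first exact: num_real.
rewrite /= normrM (le_trans _ (ltW MK))// (le_trans _ (YM om))//.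
rewrite prod_indicE indicE ler_piMr//.
by case: (_ \in _); rewrite ?normr1 ?normr0.
Qed.

Lemma mean_indep_integral l Y y : mean_indep l Y y ->
  P.-integrable setT (EFin \o Y) /\ (\int[P]_om Y om)%R = y.
Proof.
move=> Yl; have := mean_indep_integrable [::] Yl.
have [_ _ /(_ [::] isT isT)] := Yl.
rewrite /= mulr1; under eq_Rintegral do rewrite big_nil mulr1.
by under [X in _ -> P.-integrable _ (EFin \o X) -> _]eq_fun do rewrite big_nil mulr1.
Qed.

(** The base case, and the place where independence of the events enters: the intersection over [s]
    has probability [p ^+ size s]. *)
Lemma mean_indep_cst l c : mean_indep l (fun=> c) c.
Proof.
split => [|| s s_uniq _]; first exact: measurable_cst.
  by exists `|c|.
have Is : P (\bigcap_(k in [set` s]) E k) = (p ^+ size s)%:E.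
  rewrite E_indep//; elim: s {s_uniq} => [|k s IHs]; first by rewrite big_nil.
  by rewrite big_cons {}IHs E_prob exprS EFinM.
have mI : measurable (\bigcap_(k in [set` s]) E k).
  by apply: bigcap_measurableType => // *; exact: E_meas.
under eq_Rintegral do rewrite prod_indicE.
rewrite RintegralZl//; last exact: (integrable_indic P mI).
by rewrite /Rintegral integral_indic// setIT; congr (_ * _); exact: (congr1 fine Is).
Qed.

Lemma mean_indepD l Y y Z z : mean_indep l Y y -> mean_indep l Z z ->
  mean_indep l (fun om => Y om + Z om) (y + z).
Proof.
move=> Yl Zl; have [mY [MY YM] Yi] := Yl; have [mZ [MZ ZM] Zi] := Zl.
split => [|| s s_uniq sl]; first exact: measurable_funD.
  by exists (MY + MZ) => om; rewrite (le_trans (ler_normD _ _))// lerD.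
under eq_Rintegral do rewrite mulrDl.
rewrite RintegralD//; [|exact: mean_indep_integrable Yl|exact: mean_indep_integrable Zl].
by rewrite Yi// Zi// mulrDl.
Qed.

Lemma mean_indepZ l c Y y : mean_indep l Y y ->
  mean_indep l (fun om => c * Y om) (c * y).
Proof.
move=> Yl; have [mY [M YM] Yi] := Yl.
split => [|| s s_uniq sl]; first exact: measurable_funM.
  by exists (`|c| * M) => om; rewrite normrM ler_wpM2l.
under eq_Rintegral do rewrite -mulrA.
by rewrite RintegralZl ?Yi ?mulrA//; exact: mean_indep_integrable Yl.
Qed.

Lemma mean_indep_sum l (I : finType) (Y : I -> Omega -> R) (y : I -> R) :
  (forall i, mean_indep l (Y i) (y i)) ->
  mean_indep l (fun om => \sum_i Y i om) (\sum_i y i).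
Proof.
move=> Yl; pose F i om := Y i om.
have -> : (fun om => \sum_i Y i om) = \sum_i F i.
  by apply/funext => om; rewrite fct_sumE.
elim/big_ind2 : _ => // [|Y1 y1 Y2 y2]; first exact: mean_indep_cst.
exact: mean_indepD.
Qed.

(** The new indicator is absorbed into the list: [l :: s] is still duplicate-free when [s] lies
    beyond [l], and its extra element gives the factor [p]. *)
Lemma mean_indep_mul_indic l Y y : mean_indep l Y y ->
  mean_indep l.+1 (fun om => Y om * \1_(E l) om) (y * p).
Proof.
move=> [mY [M YM] Yi]; split => [|| s s_uniq sl].
- by apply: measurable_funM => //; exact: measurable_indic.
- exists M => om; rewrite normrM (le_trans _ (YM om))// ler_piMr// indicE.
  by case: (_ \in _); rewrite ?normr1 ?normr0.
have -> : (\int[P]_om (Y om * \1_(E l) om * \prod_(k <- s) \1_(E k) om) =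
    \int[P]_om (Y om * \prod_(k <- l :: s) \1_(E k) om))%R.
  by apply: eq_Rintegral => om _; rewrite big_cons mulrA.
rewrite Yi/= ?exprS ?mulrA//.
  rewrite s_uniq andbT; apply/negP => /(allP sl)/=; by rewrite ltnn.
by rewrite leqnn/=; apply: sub_all sl => k; exact: ltnW.
Qed.

Lemma mean_indep_weaken l Y y : mean_indep l Y y -> mean_indep l.+1 Y y.
Proof.
move=> [mY YM Yi]; split => // s s_uniq sl; apply: Yi => //.
by apply: sub_all sl => k; exact: ltnW.
Qed.

Lemma mean_indep_mulmx n l (M : 'M[R]_n) (Y : Omega -> 'cV[R]_n) (y c : 'cV[R]_n) :
  (forall i, mean_indep l (fun om => Y om i 0) (y i 0)) ->
  forall i, mean_indep l (fun om => (M *m Y om + c) i 0) ((M *m y + c) i 0).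
Proof.
move=> Yl i; rewrite mxE [X in X + _]mxE; under eq_fun do rewrite mxE [X in X + _]mxE.
apply: mean_indepD; last exact: mean_indep_cst.
by apply: mean_indep_sum => j; exact: mean_indepZ.
Qed.

End MeanIndependence.

(** The integral of a nonnegative function is a supremum over the simple functions below it, and
    those below [X] are also below [Y]. In this form the error can be compared with its bound
    without studying its measurability. *)
Lemma expectation_le_Rintegral (R : realType) (disp : measure_display)
    (Omega : measurableType disp) (P : probability Omega R) (X Y : Omega -> R) :
  (forall om, 0 <= X om <= Y om) -> P.-integrable setT (EFin \o Y) ->
  ('E_P[X] <= ((\int[P]_om Y om)%R)%:E)%E.
Proof.
move=> XY Yint; rewrite /Rintegral fineK ?integrable_fin_num// unlock.
have X0 om : 0 <= X om by have /andP[] := XY om.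
have Y0 om : 0 <= Y om by have /andP[_] := XY om; exact: le_trans.
rewrite !ge0_integralTE; try by move=> om; rewrite lee_fin.
apply: le_ereal_sup => _ [h hX <-]; exists h => // om.
by apply: (le_trans (hX om)); rewrite lee_fin; have /andP[] := XY om.
Qed.

(** The tail suprema of [u] are below those of [v], and the limit superior of the convergent [v] is
    its limit. *)
Lemma limn_esup_le_lim (R : realType) (u : (\bar R)^nat) (v : R^nat) (a : R) :
  (forall k, (u k <= (v k)%:E)%E) -> v @ \oo --> a -> (limn_esup u <= a%:E)%E.
Proof.
move=> uv va.
have vaE : (v k)%:E @[k --> \oo] --> a%:E by apply: cvg_EFin => //; exact: nearW.
rewrite -(cvg_limn_einf_sup vaE).2 !limn_esup_lim.
apply: lee_lim; [exact: is_cvg_esups|exact: is_cvg_esups|].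
near=> k; apply: ub_ereal_sup => _ [m /= km <-].
by apply: (le_trans (uv m)); apply: ereal_sup_ubound; exists m.
Unshelve. all: by end_near. Qed.

(** * The recursion for the mean widths *)

Section MeanWidth.
Context {R : realType} {disp : measure_display} {Omega : measurableType disp}.
Context (P : probability Omega R) (E : nat -> set Omega) (pe : R).
Hypothesis E_meas : forall l, measurable (E l).
Hypothesis E_prob : forall l, P (E l) = (1 - pe)%:E.
Hypothesis E_indep : independent_events P E.
Context {n : nat} (J : 'M[R]_n) (r : 'I_n -> nat) (c V : 'cV[R]_n).

Definition mean_gain : 'M[R]_n :=
  pe *: 1%:M + (1 - pe) *: diag_mx (\row_i (2 ^- r i)).

Fixpoint mean_width (l : nat) : 'cV[R]_n :=
  mean_gain *m (if l is l'.+1 then abs_mx J *m mean_width l' + c else V).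

Lemma mul_mean_gain m (B : 'M[R]_(n, m)) i j :
  (mean_gain *m B) i j = (pe + (1 - pe) * 2 ^- r i) * B i j.
Proof.
by rewrite mulmxDl -!scalemxAl mul1mx mul_diag_mx !mxE; ring.
Qed.

(** The gain is affine in the indicator of success, [1 + (2 ^- r i - 1) * \1_(E l)], so its mean is
    [1 + (2 ^- r i - 1) * (1 - pe) = pe + (1 - pe) * 2 ^- r i]. *)
Lemma mean_indep_gain l (Y : Omega -> 'cV[R]_n) (y : 'cV[R]_n) i :
  mean_indep P E (1 - pe) l (fun om => Y om i 0) (y i 0) ->
  mean_indep P E (1 - pe) l.+1
    (fun om => (gain r `[< E l om >] *m Y om) i 0) ((mean_gain *m y) i 0).
Proof.
move=> Yl.
have -> : (fun om => (gain r `[< E l om >] *m Y om) i 0) =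
    (fun om => Y om i 0 + (2 ^- r i - 1) * (Y om i 0 * \1_(E l) om)).
  apply/funext => om; rewrite mul_diag_mx !mxE indicE.
  have -> : (om \in E l) = `[< E l om >] by [].
  by case: asbool => /=; ring.
have -> : (mean_gain *m y) i 0 = y i 0 + (2 ^- r i - 1) * (y i 0 * (1 - pe)).
  by rewrite mul_mean_gain; ring.
apply: mean_indepD => //; first exact: mean_indep_weaken.
by apply: mean_indepZ => //; exact: mean_indep_mul_indic.
Qed.

(** The level is [l.+1] because these widths involve the outcomes of messages 0 to [l], so the next
    gain is still independent of them. *)
Lemma mean_width_after l i :
  mean_indep P E (1 - pe) l.+1
    (fun om => width_after J r c V (fun k => `[< E k om >]) l i 0)
    (mean_width l i 0).
Proof.
elim: l i => [|l IHl] i /=.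
  by apply: (mean_indep_gain (Y := fun=> V)); exact: mean_indep_cst.
apply: (mean_indep_gain (Y := fun om => abs_mx J *m width_after J r c V
  (fun k => `[< E k om >]) l + c)).
exact: mean_indep_mulmx.
Qed.

End MeanWidth.

(** * The steady-state bound *)

Theorem theorem3 (R : realType) (n : nat)
  (A Phi J : 'M[R]_n) (W : 'cV[R]_n) (lam : 'I_n -> R)
  (T d : nat) (pe : R) (rtot : nat) (r : 'I_n -> nat)
  (disp : measure_display) (Omega : measurableType disp)
  (P : probability Omega R) (success : nat -> set Omega)
  (enc : @encoder R n) (b0 : box R n)
  (x0 : 'cV[R]_n) (w : nat -> 'cV[R]_n)
  (W_ge0 : forall i, 0 <= W i 0)
  (T_gt0 : (1 <= T)%N) (d_le_T : (d <= T)%N)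
  (pe01 : 0 <= pe <= 1)
  (r_sum : (\sum_(i < n) r i = rtot)%N)
  (success_meas : forall l, measurable (success l))
  (success_prob : forall l, P (success l) = (1 - pe)%:E)
  (success_indep : independent_events P success)
  (enc_valid : valid_encoder r enc)
  (Phi_unit : Phi \in unitmx)
  (J_jordan : jordan_form J)
  (A_jordan : A ^+ T = invmx Phi *m J *m Phi)
  (A_eigen : real_eigenvalue_list A lam)
  (J_diag : forall i, J i i = lam i ^+ T)
  (rate : forall i, (pe + (1 - pe) * 2 ^- r i) * `|lam i| ^+ T < 1)
  (x0_in : in_box (Phi *m x0) b0)
  (w_bound : forall k i, - (W i 0 / 2) <= w k i 0 <= W i 0 / 2) :
  let x := state A x0 w in
  let xhat (om : Omega) (l : nat) :=
    estimate A Phi J W T d r enc b0 x (fun l' => `[< success l' om >]) l in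
  exists Delta : 'cV[R]_n,
    unique (steady_width_eq A Phi J W T r pe) Delta /\
    (limn_esup (fun l : nat =>
       'E_P[fun om => norm1 (x (l * T + d)%N - xhat om l)%R])
     <= (2^-1 * opnorm1 (A ^+ d *m invmx Phi) * (\sum_(i < n) Delta i 0)
         + \sum_(m < d) opnorm1 (A ^+ m) * (\sum_(i < n) 2^-1 * W i 0))%:E)%E.
Proof.
move=> x xhat.
set c := \sum_(m < T) abs_mx (Phi *m A ^+ m) *m W.
pose Q := mean_gain pe r; pose M := Q *m abs_mx J.
pose t om l := `[< success l om >].
have Mrow i j : M i j = (pe + (1 - pe) * 2 ^- r i) * `|J i j|.
  by rewrite mul_mean_gain [abs_mx J _ _]mxE.
have Mtrig (i j : 'I_n) : (j < i)%N -> M i j = 0.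
  move=> ji; rewrite Mrow; have := J_jordan i j.
  by rewrite (ltn_eqF ji) (ltn_eqF (ltnW ji : (j < i.+1)%N)) => ->; rewrite normr0 mulr0.
(* By [J_diag] the diagonal entry is exactly the quantity bounded in [rate]. *)
have Mdiag i : `|M i i| < 1.
  rewrite Mrow J_diag normrX normrM normrX normr_id; apply: le_lt_trans (rate i).
  have /andP[pe0 pe1] := pe01.
  by rewrite ger0_norm// addr_ge0// mulr_ge0 ?subr_ge0// invr_ge0 exprn_ge0.
have steadyE D : steady_width_eq A Phi J W T r pe D <-> D = M *m D + Q *m c.
  by rewrite /steady_width_eq -/c mulmxDr mulmxA.
have M1 := trig_sub1_unit Mtrig Mdiag.
(* The steady-width equation reads [(1%:M - M) *m D = Q *m c]; invertibility gives both existence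
   and uniqueness. *)
pose Delta := invmx (1%:M - M) *m (Q *m c).
have DeltaE : Delta = M *m Delta + Q *m c.
  have /eqP : (1%:M - M) *m Delta = Q *m c by rewrite mulKVmx.
  by rewrite mulmxBl mul1mx subr_eq addrC => /eqP.
exists Delta; split.
  split; first exact/steadyE.
  move=> D /steadyE DE; rewrite /Delta -[RHS](mulKmx M1); congr (_ *m _).
  by rewrite mulmxBl mul1mx {1}DE addrAC subrr add0r.
pose u := mean_width pe J r c (width b0).
have uE k : u k.+1 = M *m u k + Q *m c by rewrite /u /= mulmxDr mulmxA.
have u_cvg i : u k i 0 @[k --> \oo] --> Delta i 0 by exact: affine_iter_cvg DeltaE uE.
pose a := 2^-1 * opnorm1 (A ^+ d *m invmx Phi).
pose b := \sum_(m < d) opnorm1 (A ^+ m) * (\sum_i 2^-1 * W i 0).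
apply: (@limn_esup_le_lim _ _ (fun k => a * (\sum_i u k i 0) + b)); last first.
  apply: cvgD; last exact: cvg_cst.
  by apply: cvgM; [exact: cvg_cst|apply: cvg_big => //; exact: add_continuous].
move=> l.
(* The pathwise error bound is affine in the widths, so its mean is the same expression evaluated at
   the mean widths [u l]. *)
have Yl : mean_indep P success (1 - pe) l.+1
    (fun om => a * (\sum_i width_after J r c (width b0) (t om) l i 0) + b)
    (a * (\sum_i u l i 0) + b).
  apply: mean_indepD => //; last exact: mean_indep_cst.
  apply: mean_indepZ => //; apply: mean_indep_sum => // i.
  exact: mean_width_after.
have [Yint <-] := mean_indep_integral success_meas Yl.
apply: expectation_le_Rintegral Yint => om; rewrite norm1_ge0/=.
exact: estimate_error_le.
Qed.
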